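(* Let $\mathbf{k}$ be a commutative ring and $L$ a $\mathbf{k}$-module. (a) We have $\partial_g(\operatorname{Ker}\mathbf{t})=0$ for every $g\in L^{\ast}$. (b) Assume that $L$ is a free $\mathbf{k}$-module. Then $$\operatorname{Ker}\mathbf{t}=\{U\in T(L)\mid \partial_g(U)=0\text{ for every }g\in L^{\ast}\}.$$
   Context: Let $\mathbb{N}=\{0,1,2,\ldots\}$; all tensor products are over $\mathbf{k}$. $T(L)=\bigoplus_{n\in\mathbb{N}} L^{\otimes n}$ is the tensor algebra of $L$. $L^{\ast}=\operatorname{Hom}_{\mathbf{k}}(L,\mathbf{k})$ is the dual module. A hat $\widehat{u_i}$ means that the factor $u_i$ is omitted from its usual place. $\mathbf{t}:T(L)\to T(L)$ is the $\mathbf{k}$-linear map given by $\mathbf{t}(u_1\otimes\cdots\otimes u_k)=\sum_{i=1}^{k}(-1)^{i-1}u_i\otimes u_1\otimes u_2\otimes\cdots\otimes\widehat{u_i}\otimes\cdots\otimes u_k$ for all $k\in\mathbb{N}$ and $u_1,\ldots,u_k\in L$ (so $\mathbf{t}$ is $0$ on $L^{\otimes 0}$). For $g\in L^{\ast}$, $\partial_g:T(L)\to T(L)$ is the $\mathbf{k}$-linear map given by $\partial_g(u_1\otimes\cdots\otimes u_k)=\sum_{i=1}^{k}(-1)^{i-1}g(u_i)\cdot u_1\otimes u_2\otimes\cdots\otimes\widehat{u_i}\otimes\cdots\otimes u_k$ for all $k\in\mathbb{N}$ and $u_1,\ldots,u_k\in L$. *)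

(* Defs.v *)
From HB Require Import structures.
From mathcomp Require Import all_boot all_algebra.
From mathcomp Require Import boolp classical_sets.

Set Implicit Arguments.
Unset Strict Implicit.
Unset Printing Implicit Defensive.

Import GRing.Theory.
Local Open Scope ring_scope.
Local Open Scope quotient_scope.

(* A word w : seq L stands for the tuple (u_1, .., u_n) in L^n, n = size w.   *)
(* Multilinear f says that the restriction of f to words of each length n is  *)
(* k-linear in each of its n arguments.                                       *)
Definition multilinear (k : comPzRingType) (L W : lmodType k)
    (f : seq L -> W) : Prop :=
  forall (a : k) (x y : L) (u v : seq L),
    f (u ++ (a *: x + y) :: v) = a *: f (u ++ x :: v) + f (u ++ y :: v).

Section TensorAlgebra.
Variables (k : comPzRingType) (L : lmodType k).

(* T(L), the direct sum of the tensor powers of L, is the k-module generated  *)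
(* by all words w = (u_1, .., u_n), n in nat, subject to the multilinearity   *)
(* relations.  It is realized as the quotient of the type of formal sums      *)
(*   a_1 w_1 + .. + a_m w_m                                                   *)
(* by the congruence teq generated by the module axioms (the first seven      *)
(* constructors) and by multilinearity (the last one).                        *)
(* tensalg_universal below is the universal property of this module.          *)
Definition formal_sum := seq (k * seq L).

Inductive teq : formal_sum -> formal_sum -> Prop :=
| teq_refl s : teq s s
| teq_sym s1 s2 : teq s1 s2 -> teq s2 s1
| teq_trans s1 s2 s3 : teq s1 s2 -> teq s2 s3 -> teq s1 s3
| teq_cat s1 s2 r1 r2 : teq s1 r1 -> teq s2 r2 -> teq (s1 ++ s2) (r1 ++ r2)
| teq_catC s1 s2 : teq (s1 ++ s2) (s2 ++ s1)
| teq_zero w : teq [:: (0, w)] [::]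
| teq_add a b w : teq [:: (a, w); (b, w)] [:: (a + b, w)]
| teq_lin a c x y u v :
    teq [:: (a, u ++ (c *: x + y) :: v)]
        [:: (a * c, u ++ x :: v); (a, u ++ y :: v)].

Definition teqb : rel formal_sum := fun s1 s2 => `[< teq s1 s2 >].

Lemma teqb_refl : reflexive teqb.
Proof. by move=> s; apply/asboolP; exact: teq_refl. Qed.

Lemma teqb_sym : symmetric teqb.
Proof. by move=> s1 s2; apply/asboolP/asboolP; exact: teq_sym. Qed.

Lemma teqb_trans : transitive teqb.
Proof.
move=> s1 s2 s3 /asboolP h1 /asboolP h2; apply/asboolP; exact: teq_trans h1 h2.
Qed.

Canonical teqb_equiv := EquivRel teqb teqb_refl teqb_sym teqb_trans.

Definition tensalg := {eq_quot teqb_equiv}.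
HB.instance Definition _ := Choice.on tensalg.
HB.instance Definition _ : EqQuotient formal_sum teqb_equiv tensalg :=
  EqQuotient.on tensalg.

Definition tclass (s : formal_sum) : tensalg := \pi_tensalg s.

Lemma tclassP s1 s2 : tclass s1 = tclass s2 <-> teq s1 s2.
Proof.
split=> [/eqquotP /asboolP //|h].
by apply/eqquotP; apply/asboolP.
Qed.

Lemma tclass_repr U : tclass (repr U) = U.
Proof. exact: reprK. Qed.

Lemma teq_repr s : teq (repr (tclass s)) s.
Proof. by apply/tclassP; rewrite tclass_repr. Qed.

Definition fscale (a : k) (s : formal_sum) : formal_sum :=
  [seq (a * p.1, p.2) | p <- s].

Lemma fscale_cat a s1 s2 : fscale a (s1 ++ s2) = fscale a s1 ++ fscale a s2.
Proof. exact: map_cat. Qed.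

Lemma teq_fscale a s1 s2 : teq s1 s2 -> teq (fscale a s1) (fscale a s2).
Proof.
elim=> {s1 s2} [s|s1 s2 _ IH|s1 s2 s3 _ IH1 _ IH2|s1 s2 r1 r2 _ IH1 _ IH2
  |s1 s2|w|b c w|b c x y u v]; rewrite ?fscale_cat.
- exact: teq_refl.
- exact: teq_sym.
- exact: teq_trans IH1 IH2.
- exact: teq_cat.
- exact: teq_catC.
- by rewrite /fscale /= mulr0; exact: teq_zero.
- by rewrite /fscale /= mulrDr; exact: teq_add.
- by rewrite /fscale /= mulrA; exact: teq_lin.
Qed.

Definition tadd (U V : tensalg) : tensalg := tclass (repr U ++ repr V).
Definition topp (U : tensalg) : tensalg := tclass (fscale (-1) (repr U)).
Definition tscale (a : k) (U : tensalg) : tensalg := tclass (fscale a (repr U)).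

Lemma tadd_class s1 s2 : tadd (tclass s1) (tclass s2) = tclass (s1 ++ s2).
Proof. by apply/tclassP; apply: teq_cat; exact: teq_repr. Qed.

Lemma tscale_class a s : tscale a (tclass s) = tclass (fscale a s).
Proof. by apply/tclassP; apply: teq_fscale; exact: teq_repr. Qed.

Lemma tensalg_ind (P : tensalg -> Prop) :
  (forall s, P (tclass s)) -> forall U, P U.
Proof. by move=> h U; rewrite -(tclass_repr U). Qed.

Lemma taddA : associative tadd.
Proof.
move=> U V W; elim/tensalg_ind: U => s; elim/tensalg_ind: V => t.
by elim/tensalg_ind: W => r; rewrite !tadd_class catA.
Qed.

Lemma taddC : commutative tadd.
Proof. by move=> U V; apply/tclassP; exact: teq_catC. Qed.

Lemma tadd0 : left_id (tclass [::]) tadd.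
Proof. by elim/tensalg_ind=> s; rewrite tadd_class. Qed.

Lemma teq_scaleDl a b s : teq (fscale a s ++ fscale b s) (fscale (a + b) s).
Proof.
elim: s => [|[c w] s IH]; first exact: teq_refl.
rewrite /= -cat1s -[_ :: (fscale b s)]cat1s -[X in teq _ X]cat1s.
have h : teq ([:: (a * c, w)] ++ [:: (b * c, w)]) [:: ((a + b) * c, w)].
  by rewrite mulrDl; exact: teq_add.
apply: teq_trans (teq_cat h IH).
rewrite -!catA; apply: teq_cat; first exact: teq_refl.
rewrite !catA; apply: teq_cat; [exact: teq_catC | exact: teq_refl].
Qed.

Lemma teq_scale0 s : teq (fscale 0 s) [::].
Proof.
elim: s => [|[c w] s IH]; first exact: teq_refl.
by rewrite /= mul0r; exact: (teq_cat (teq_zero w) IH).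
Qed.

Lemma fscale1 s : fscale 1 s = s.
Proof. by elim: s => [//|[c w] s IH] /=; rewrite mul1r IH. Qed.

Lemma taddN : left_inverse (tclass [::]) topp tadd.
Proof.
elim/tensalg_ind=> s; rewrite /topp -/(tscale _ _) tscale_class tadd_class.
apply/tclassP; rewrite -{2}(fscale1 s).
by apply: teq_trans (teq_scaleDl _ _ _) _; rewrite addNr; exact: teq_scale0.
Qed.

HB.instance Definition _ := GRing.isZmodule.Build tensalg taddA taddC tadd0 taddN.

Lemma tclass_cat s1 s2 : tclass (s1 ++ s2) = tclass s1 + tclass s2.
Proof. by rewrite -tadd_class. Qed.

Lemma tscaleA a b U : tscale a (tscale b U) = tscale (a * b) U.
Proof.
elim/tensalg_ind: U => s; rewrite !tscale_class /fscale -map_comp.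
by congr tclass; apply: eq_map => -[c w] /=; rewrite mulrA.
Qed.

Lemma tscale1 : left_id 1 tscale.
Proof. by elim/tensalg_ind=> s; rewrite tscale_class fscale1. Qed.

Lemma tscaleDr : right_distributive tscale +%R.
Proof.
move=> a U V; elim/tensalg_ind: U => s; elim/tensalg_ind: V => t.
by rewrite -tclass_cat !tscale_class fscale_cat tclass_cat.
Qed.

Lemma tscaleDl U : {morph tscale^~ U : a b / a + b}.
Proof.
move=> a b; elim/tensalg_ind: U => s; rewrite /= !tscale_class -tclass_cat.
by apply/tclassP; apply: teq_sym; exact: teq_scaleDl.
Qed.

HB.instance Definition _ := GRing.Zmodule_isLmodule.Build k tensalg
  tscaleA tscale1 tscaleDr tscaleDl.

Lemma tclass_scale a s : tclass (fscale a s) = a *: tclass s.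
Proof. by rewrite -tscale_class. Qed.

(* The pure tensor u_1 (x) .. (x) u_n. *)
Definition tens (w : seq L) : tensalg := tclass [:: (1, w)].

Lemma tclassE s : tclass s = \sum_(p <- s) p.1 *: tens p.2.
Proof.
elim: s => [|[a w] s IH]; first by rewrite big_nil.
by rewrite big_cons -cat1s tclass_cat IH -tclass_scale /fscale /= mulr1.
Qed.

Lemma tens_multilinear : multilinear tens.
Proof.
move=> a x y u v; rewrite -tclass_scale -tclass_cat /fscale /= mulr1.
by apply/tclassP; have := teq_lin 1 a x y u v; rewrite mul1r.
Qed.

Lemma tens_span (U : tensalg) :
  exists s : seq (k * seq L), U = \sum_(p <- s) p.1 *: tens p.2.
Proof. by exists (repr U); rewrite -tclassE tclass_repr. Qed.

(* The linear extension of f to T(L); meaningful when f is multilinear. *)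
Definition textend (W : lmodType k) (f : seq L -> W) (U : tensalg) : W :=
  \sum_(p <- repr U) p.1 *: f p.2.

Lemma textend_class (W : lmodType k) (f : seq L -> W) s :
  multilinear f -> textend f (tclass s) = \sum_(p <- s) p.1 *: f p.2.
Proof.
move=> mf; rewrite /textend; move: (repr _) (teq_repr s) => r.
elim=> {r s} [s|s1 s2 _ -> //|s1 s2 s3 _ -> _ -> //|s1 s2 r1 r2 _ IH1 _ IH2
  |s1 s2|w|a b w|a c x y u v].
- by [].
- by rewrite !big_cat /= IH1 IH2.
- by rewrite !big_cat /= addrC.
- by rewrite big_seq1 big_nil scale0r.
- by rewrite !big_cons !big_nil !addr0 scalerDl.
- by rewrite !big_cons !big_nil !addr0 /= mf scalerDr scalerA.
Qed.

Lemma textend_tens (W : lmodType k) (f : seq L -> W) w :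
  multilinear f -> textend f (tens w) = f w.
Proof. by move=> mf; rewrite textend_class // big_seq1 scale1r. Qed.

Lemma textend_linear (W : lmodType k) (f : seq L -> W) :
  multilinear f -> linear (textend f).
Proof.
move=> mf a U V; elim/tensalg_ind: U => s; elim/tensalg_ind: V => t.
rewrite -tclass_scale -tclass_cat !textend_class // big_cat /= big_map.
by rewrite scaler_sumr; congr (_ + _); apply: eq_bigr => p _; rewrite scalerA.
Qed.

Lemma tensalg_linear_ext (W : lmodType k) (f g : {linear tensalg -> W}) :
  (forall w, f (tens w) = g (tens w)) -> f =1 g.
Proof.
move=> fg U; have [s ->] := tens_span U.
by rewrite !linear_sum; apply: eq_bigr => p _; rewrite !linearZ_LR fg.
Qed.

Theorem tensalg_universal (W : lmodType k) (f : seq L -> W) :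
  multilinear f ->
  exists h : {linear tensalg -> W},
    (forall w, h (tens w) = f w) /\
    (forall h' : {linear tensalg -> W},
        (forall w, h' (tens w) = f w) -> h' =1 h).
Proof.
move=> mf.
pose h : {linear tensalg -> W} :=
  HB.pack (textend f) (GRing.isLinear.Build _ _ _ _ _ (textend_linear mf)).
exists h; split=> [w|h' hh']; first exact: textend_tens.
apply: tensalg_linear_ext => w.
by rewrite hh' /= textend_tens.
Qed.

Definition omit (i : nat) (w : seq L) : seq L := take i w ++ drop i.+1 w.

Lemma omit_slot i (u v : seq L) : i != size u ->
  exists u' v', forall x : L, omit i (u ++ x :: v) = u' ++ x :: v'.
Proof.
rewrite /omit neq_ltn => /orP[iu|ui].
  exists (take i u ++ drop i.+1 u), v => x.
  rewrite takel_cat ?(ltnW iu)// drop_cat -catA; case: ltnP => // ui.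
  have e : i.+1 = size u by apply/eqP; rewrite eqn_leq iu.
  by rewrite e subnn drop_size.
exists u, (omit (i - size u).-1 v) => x.
rewrite take_cat drop_cat !ltnNge (ltnW ui) (leqW (ltnW ui)) /=.
rewrite subSn ?(ltnW ui) // -catA; rewrite -subn_gt0 in ui.
by case: (i - size u)%N ui.
Qed.

Lemma omit_size (u v : seq L) x : omit (size u) (u ++ x :: v) = u ++ v.
Proof.
by rewrite /omit take_size_cat // -cat_rcons drop_size_cat ?size_rcons.
Qed.

Lemma nth_slot i (u v : seq L) (x y : L) : i != size u ->
  (u ++ x :: v)`_i = (u ++ y :: v)`_i.
Proof.
rewrite !nth_cat => iu; case: ltnP => // ui.
rewrite leq_eqVlt eq_sym (negbTE iu) /= -subn_gt0 in ui.
by case: (i - size u)%N ui.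
Qed.

(* Both t and d_g are given on pure tensors.  Positions are numbered from 0,  *)
(* so that the sign of the i-th factor is (-1)^i.                             *)
Definition tmap_word (w : seq L) : tensalg :=
  \sum_(i < size w) (-1) ^+ i *: tens (w`_i :: omit i w).

Definition pd_word (g : {scalar L}) (w : seq L) : tensalg :=
  \sum_(i < size w) (-1) ^+ i *: (g w`_i *: tens (omit i w)).

Definition tmap : tensalg -> tensalg := textend tmap_word.

Definition pd (g : {scalar L}) : tensalg -> tensalg := textend (pd_word g).

Lemma tmap_word_multilinear : multilinear tmap_word.
Proof.
move=> a x y u v; rewrite /tmap_word !size_cat /= scaler_sumr -big_split /=.
apply: eq_bigr => i _; rewrite !scalerA mulrC -!scalerA -scalerDr.
congr (_ *: _); have [iu|iu] := eqVneq (i : nat) (size u).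
  rewrite iu !omit_size !nth_cat ltnn subnn /=.
  exact: (tens_multilinear a x y [::]).
have [u' [v' h]] := omit_slot v iu; rewrite !h.
rewrite (nth_slot v _ x iu) (nth_slot v y x iu).
exact: (tens_multilinear a x y (_ :: u')).
Qed.

Lemma pd_word_multilinear g : multilinear (pd_word g).
Proof.
move=> a x y u v; rewrite /pd_word !size_cat /= scaler_sumr -big_split /=.
apply: eq_bigr => i _; rewrite (scalerA a) mulrC -scalerA -scalerDr.
congr (_ *: _); have [iu|iu] := eqVneq (i : nat) (size u).
  by rewrite iu !omit_size !nth_cat ltnn subnn /= scalarP scalerDl scalerA.
have [u' [v' h]] := omit_slot v iu; rewrite !h.
rewrite (nth_slot v _ x iu) (nth_slot v y x iu) tens_multilinear.
by rewrite scalerDr !scalerA mulrC.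
Qed.

HB.instance Definition _ :=
  GRing.isLinear.Build k tensalg tensalg *:%R tmap
    (textend_linear tmap_word_multilinear).

HB.instance Definition _ g :=
  GRing.isLinear.Build k tensalg tensalg *:%R (pd g)
    (textend_linear (@pd_word_multilinear g)).

Lemma tmap_tens (w : seq L) :
  tmap (tens w) = \sum_(i < size w) (-1) ^+ i *: tens (w`_i :: omit i w).
Proof. exact/textend_tens/tmap_word_multilinear. Qed.

Lemma pd_tens (g : {scalar L}) (w : seq L) :
  pd g (tens w) =
  \sum_(i < size w) (-1) ^+ i *: (g w`_i *: tens (omit i w)).
Proof. exact/textend_tens/pd_word_multilinear. Qed.

End TensorAlgebra.

(* L has a basis (e_i), i in I, with I possibly infinite: every vector is a   *)
(* finite linear combination of the e_i, and the e_i are linearly independent.*)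
Definition free_module (k : comPzRingType) (L : lmodType k) : Prop :=
  exists (I : choiceType) (e : I -> L),
    (forall x : L, exists (s : seq I) (c : I -> k),
        x = \sum_(i <- s) c i *: e i) /\
    (forall (s : seq I) (c : I -> k), uniq s ->
        \sum_(i <- s) c i *: e i = 0 -> forall i, i \in s -> c i = 0).

Definition Ker (k : comPzRingType) (V W : lmodType k)
    (f : {linear V -> W}) : set V := [set x | f x = 0]%classic.

(* Main.v *)
From HB Require Import structures.
Require Import Defs.
From mathcomp Require Import all_boot all_algebra.
From mathcomp Require Import boolp classical_sets.
Import GRing.Theory.
Local Open Scope ring_scope.
Local Open Scope classical_set_scope.

(** Contracting the first tensor factor against [g] gives a linear map [c_g]
    with [pd g = c_g \o t], whence (a).  If [L] has basis [e_i] with coordinate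
    forms [g_i], every tensor [V] of positive degree is the finite sum of the
    [e_i (x) c_(g_i) V]; for [V = t U] this reads
    [t U = \sum_i e_i (x) pd g_i U], whence (b). *)

(** Freezing all slots but one leaves a linear map, which commutes with finite sums. *)
Lemma multilinear_sum {k : comPzRingType} {L W : lmodType k} (f : seq L -> W)
    (I : Type) (t : seq I) (a : I -> k) (x : I -> L) (u v : seq L) :
  multilinear f ->
  f (u ++ (\sum_(i <- t) a i *: x i) :: v) =
  \sum_(i <- t) a i *: f (u ++ x i :: v).
Proof.
move=> mf.
have slot_lin : linear (fun y => f (u ++ y :: v)) by move=> c y z; exact: mf.
pose h : {linear L -> W} :=
  HB.pack (fun y => f (u ++ y :: v)) (GRing.isLinear.Build _ _ _ _ _ slot_lin).
rewrite -[LHS]/(h _) linear_sum; apply: eq_bigr => i _.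
by rewrite linearZ_LR.
Qed.

Section Contraction.
Context {k : comPzRingType} {L : lmodType k}.

Definition contract_word (g : {scalar L}) (w : seq L) : tensalg L :=
  if w is x :: w' then g x *: tens w' else 0.

Lemma contract_word_multilinear g : multilinear (contract_word g).
Proof.
move=> a x y [|z u] v /=; first by rewrite scalarP scalerDl scalerA.
by rewrite tens_multilinear scalerDr !scalerA mulrC.
Qed.

Definition contract g : tensalg L -> tensalg L := textend (contract_word g).

HB.instance Definition _ g :=
  GRing.isLinear.Build k (tensalg L) (tensalg L) *:%R (contract g)
    (textend_linear (contract_word_multilinear g)).

(** On a pure tensor, contracting the factor that [tmap] moves to the front turns each term into the
    matching term of [pd g], with the same sign. *)
Lemma contract_tmap g (U : tensalg L) : contract g (tmap U) = pd g U.
Proof.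
apply: (tensalg_linear_ext (f := contract g \o @tmap k L) (g := pd g)) => w /=.
rewrite tmap_tens pd_tens linear_sum; apply: eq_bigr => i _.
rewrite linearZ_LR; congr (_ *: _).
by rewrite /= [LHS]textend_tens //; exact: contract_word_multilinear.
Qed.

(** Left multiplication by [x] in T(L), on pure tensors. *)
Definition tcons_word (x : L) (w : seq L) : tensalg L := tens (x :: w).

Lemma tcons_word_multilinear x : multilinear (tcons_word x).
Proof. by move=> a y z u v; exact: (tens_multilinear a y z (x :: u)). Qed.

Definition tcons x : tensalg L -> tensalg L := textend (tcons_word x).

HB.instance Definition _ x :=
  GRing.isLinear.Build k (tensalg L) (tensalg L) *:%R (tcons x)
    (textend_linear (tcons_word_multilinear x)).

Lemma tcons_tens x w : tcons x (tens w) = tens (x :: w).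
Proof. exact/textend_tens/tcons_word_multilinear. Qed.

(** In each term of [tmap] only the factor moved to the front is expanded in the [e i]; exchanging
    the two sums then collects, for each [i], the terms of [pd (g i)]. *)
Lemma tmap_tens_expand (I : Type) (e : I -> L) (g : I -> {scalar L})
    (t : seq I) (w : seq L) :
  (forall x, x \in w -> x = \sum_(i <- t) g i x *: e i) ->
  tmap (tens w) = \sum_(i <- t) tcons (e i) (pd (g i) (tens w)).
Proof.
move=> wE; rewrite tmap_tens.
under [RHS]eq_bigr => i _ do rewrite pd_tens linear_sum.
rewrite exchange_big; apply: eq_bigr => p _.
rewrite {1}(wE w`_p) ?mem_nth //.
rewrite (multilinear_sum _ _ t _ e [::] _ (@tens_multilinear k L)).
rewrite scaler_sumr; apply: eq_bigr => i _.
rewrite [RHS]linearZ_LR; congr (_ *: _).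
by rewrite [RHS]linearZ_LR /= tcons_tens.
Qed.

End Contraction.

Section Coordinates.
Context {k : comPzRingType} {L : lmodType k} {I : choiceType} (e : I -> L).
Hypothesis e_span : forall x : L, exists (s : seq I) (c : I -> k),
  x = \sum_(i <- s) c i *: e i.
Hypothesis e_indep : forall (s : seq I) (c : I -> k), uniq s ->
  \sum_(i <- s) c i *: e i = 0 -> forall i, i \in s -> c i = 0.

(* [e_span] allows repeated indices in [s] and arbitrary values of [c] outside
   [s]; here the coefficients are normalized. *)
Lemma finsupp_expansion (x : L) : exists sc : seq I * (I -> k),
  (forall i, i \notin sc.1 -> sc.2 i = 0) /\
  (forall t, uniq t -> {subset sc.1 <= t} ->
     x = \sum_(i <- t) sc.2 i *: e i).
Proof.
have [s [c ->]] := e_span x.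
exists (s, fun i => c i *+ count_mem i s); split=> [i /= /count_memPn -> //|].
move=> t ut /= st.
(* Since [t] is duplicate-free, each [j] in [s] equals exactly one [i] in [t]; exchanging the sums
   counts [c i *: e i] once per occurrence of [i] in [s]. *)
have -> : \sum_(i <- s) c i *: e i =
          \sum_(j <- s) \sum_(i <- t | i == j) c i *: e i.
  apply: eq_big_seq => j /st jt.
  by rewrite -big_filter filter_pred1_uniq // big_seq1.
rewrite (exchange_big_dep xpredT) //=; apply: eq_bigr => i _.
rewrite big_const_seq iter_addr_0 scalerMnl.
by under eq_count => j do rewrite eq_sym.
Qed.

(** Coordinates are picked by choice, and independence forces them to be linear. Letting [t] vary
    allows several vectors to share one index list. *)
Lemma coordinate_forms : exists g : I -> {scalar L},
  forall x, exists s : seq I, forall t, uniq t -> {subset s <= t} ->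
    x = \sum_(i <- t) g i x *: e i.
Proof.
have [sc scP] := choice finsupp_expansion.
pose co i x := (sc x).2 i.
have co_lin i : scalar (co i).
  move=> a x y; set z := a *: x + y.
  (* The index [i] is added to the three supports because independence only reaches coefficients
     whose index lies in [t]. *)
  pose t := undup (i :: (sc x).1 ++ (sc y).1 ++ (sc z).1).
  have ut : uniq t by exact: undup_uniq.
  have [xt yt zt] : [/\ {subset (sc x).1 <= t}, {subset (sc y).1 <= t}
      & {subset (sc z).1 <= t}].
    by split=> j jt; rewrite mem_undup inE !mem_cat jt ?orbT.
  apply/eqP; rewrite -subr_eq0; apply/eqP.
  apply: (e_indep t (fun j => co j z - (a * co j x + co j y)) ut).
    under eq_bigr => j _ do rewrite scalerBl scalerDl -scalerA.
    rewrite sumrB big_split -scaler_sumr /=.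
    by rewrite -(scP z).2 // -(scP x).2 // -(scP y).2 // subrr.
  by rewrite mem_undup inE eqxx.
pose g i : {scalar L} :=
  HB.pack (co i) (GRing.isLinear.Build _ _ _ _ _ (co_lin i)).
by exists g => x; exists (sc x).1; exact: (scP x).2.
Qed.

End Coordinates.

(** Finitely many vectors occur as letters in a representation of [U], so one finite [t] covers all
    their supports even for an infinite basis; linearity reduces the rest to pure tensors. *)
Lemma tmap_expand {k : comPzRingType} {L : lmodType k} (U : tensalg L) :
  free_module L -> exists (I : Type) (e : I -> L) (g : I -> {scalar L})
    (t : seq I), tmap U = \sum_(i <- t) tcons (e i) (pd (g i) U).
Proof.
move=> [I [e [e_span e_indep]]].
have [g gP] := coordinate_forms e e_span e_indep.
have [sup supP] := choice gP.
have [r ->] := tens_span U.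
pose t := undup (flatten [seq sup x | x <- flatten [seq p.2 | p <- r]]).
exists I, e, g, t.
under [RHS]eq_bigr => i _ do rewrite (linear_sum (pd (g i))) linear_sum.
rewrite [LHS]linear_sum [RHS]exchange_big; apply: eq_big_seq => p pr.
under [RHS]eq_bigr => i _ do rewrite (linearZ_LR (pd (g i))) linearZ_LR.
rewrite [LHS]linearZ_LR -scaler_sumr; congr (_ *: _).
apply: tmap_tens_expand => x xp.
apply: supP; first exact: undup_uniq.
move=> i ix; rewrite mem_undup; apply/flatten_mapP; exists x => //.
by apply/flatten_mapP; exists p.
Qed.

Theorem proposition3p3 (k : comPzRingType) (L : lmodType k) :
  (forall g : {scalar L}, pd g @` Ker (@tmap k L) = [set 0]) /\
  (free_module L ->
   Ker (@tmap k L) = [set U : tensalg L | forall g : {scalar L}, pd g U = 0]).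
Proof.
have pd0 (U : tensalg L) g : tmap U = 0 -> pd g U = 0.
  by move=> tU; rewrite -contract_tmap tU linear0.
split=> [g|freeL]; apply/seteqP; split=> U.
- by case=> V /pd0 dV <-; exact: dV.
(* Equality with the set of 0 also requires 0 to be attained, namely at 0 in the kernel. *)
- by move=> ->; exists 0; rewrite /Ker /= linear0.
- by move=> /pd0 tU g; exact: tU.
- move=> /= dU; rewrite /Ker /=; have [I [e [g [t ->]]]] := tmap_expand U freeL.
  by rewrite big1 // => i _; rewrite dU linear0.
Qed.
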